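(* Let $q\in(0,2)\setminus\{1\}$. Then $|\mathsf{S}^{\mathrm{pl}}_n(q)|$ grows exponentially in $n$, i.e. \[ |\mathsf{S}^{\mathrm{pl}}_n(q)| \;=\; 2^{\Omega_{q}(n)}, \] meaning there exist $c=c(q)>0$ and $n_0=n_0(q)$ with $|\mathsf{S}^{\mathrm{pl}}_n(q)|\ge 2^{cn}$ for all $n\ge n_0$.
   Context: $P_G(x)$ denotes the chromatic polynomial of $G$. $\mathsf{S}^{\mathrm{pl}}_n(q)\coloneqq\{P_G(q): G \text{ a simple planar graph on } n\text{ vertices}\}$. *)

(* Defs.v *)
From HB Require Import structures.
From mathcomp Require Import all_boot all_order all_algebra finmap.
From mathcomp Require Import all_classical all_reals all_analysis.

Set Implicit Arguments.
Unset Strict Implicit.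
Unset Printing Implicit Defensive.

Import Order.TTheory GRing.Theory Num.Theory.
Import numFieldNormedType.Exports.

Local Open Scope classical_set_scope.
Local Open Scope ring_scope.

Definition simple_graph (T : finType) (e : rel T) : Prop :=
  symmetric e /\ irreflexive e.

Definition proper_coloring (T : finType) (e : rel T) (k : nat)
    (f : {ffun T -> 'I_k}) : bool :=
  [forall x, forall y, e x y ==> (f x != f y)].

Definition num_colorings (T : finType) (e : rel T) (k : nat) : nat :=
  #|[pred f : {ffun T -> 'I_k} | proper_coloring e f]|.

Definition is_chrompoly (T : finType) (e : rel T) (p : {poly int}) : Prop :=
  forall k : nat, p.[k%:R] = (num_colorings e k)%:R.

(* The default value 0 is never used: see [chrompolyP] and [chrompoly_uniq]. *)
Definition chrompoly (T : finType) (e : rel T) : {poly int} :=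
  xget 0 [set p | is_chrompoly e p].

(* Topological planarity: [pt] places the vertices and [arc u v], restricted
   to [0, 1], is a simple arc from [pt u] to [pt v] for each edge uv.  An edge
   is seen as (u, v) and as (v, u); the two arcs are reverses of each other, so
   that each edge has a single curve in the plane. *)
Definition plane_drawing (R : realType) (T : finType) (e : rel T)
    (pt : T -> R * R) (arc : T -> T -> R -> R * R) : Prop :=
  [/\ injective pt,
      forall u v, e u v ->
        [/\ {within `[0, 1], continuous (arc u v)},
            {in `[0, 1] &, injective (arc u v)},
            arc u v 0 = pt u, arc u v 1 = pt v &
            {in `[0, 1], forall t, arc v u t = arc u v (1 - t)}],
      forall u v w, e u v -> {in `]0, 1[, forall t, arc u v t <> pt w} &
      forall u v u' v', e u v -> e u' v' ->
        {in `]0, 1[ &, forall s t, arc u v s = arc u' v' t ->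
           (u = u' /\ v = v') \/ (u = v' /\ v = u')}].

Definition planar (R : realType) (T : finType) (e : rel T) : Prop :=
  exists (pt : T -> R * R) (arc : T -> T -> R -> R * R),
    plane_drawing e pt arc.

(* Graphs on n vertices are taken, up to isomorphism, on the vertex set 'I_n. *)
Definition Spl (R : realType) (n : nat) (q : R) : set R :=
  [set x | exists e : rel 'I_n,
     [/\ simple_graph e, planar R e & x = (map_poly intr (chrompoly e)).[q]]].

Lemma ex_constraint_poly (s : nat) (T : finType) (l : seq (T * T)) :
  size l = s ->
  exists p : {poly int}, forall k : nat, p.[k%:R] =
    #|[pred f : {ffun T -> 'I_k} | all (fun z => f z.1 != f z.2) l]|%:R.
Proof.
elim: s T l => [|s IHs] T [|[x y] l] //= => [_|[sl]].
  exists 'X^#|T| => k; rewrite hornerXn -natrX; congr (_%:R).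
  rewrite -[in LHS](card_ord k) -card_ffun.
  by apply: eq_card => f; rewrite !inE.
have [p Hp] := IHs T l sl.
have [<-{y}|neq_xy] := eqVneq x y.
  exists 0 => k; rewrite horner0 eq_card0 // => f.
  by rewrite !inE eqxx.
pose T' := {z : T | z != y}.
pose x' : T' := exist _ x neq_xy.
pose h (z : T) : T' := insubd x' z.
have hy : h y = x' by rewrite /h /insubd insubF // eqxx.
have hx : h x = x' by apply: val_inj; rewrite val_insubd neq_xy.
have hK (z : T) : z != y -> val (h z) = z by move=> zy; rewrite val_insubd zy.
have [p' Hp'] := IHs T' [seq (h z.1, h z.2) | z <- l] (eq_trans (size_map _ _) sl).
exists (p - p') => k; rewrite hornerD hornerN Hp Hp'.
pose A := [pred f : {ffun T -> 'I_k} | all (fun z => f z.1 != f z.2) l].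
pose B := [pred f : {ffun T -> 'I_k} | f x == f y].
have -> : #|A| = (#|[predI A & B]| + #|[predD A & B]|)%N.
  by rewrite -(cardID B A); congr (_ + _)%N; apply: eq_card => f; rewrite !inE // andbC.
pose lft (g : {ffun T' -> 'I_k}) : {ffun T -> 'I_k} := [ffun z => g (h z)].
have lftI : injective lft.
  move=> g1 g2 /ffunP eg; apply/ffunP => z.
  have := eg (val z); rewrite !ffunE.
  by have -> : h (val z) = z by apply: val_inj; rewrite hK // (valP z).
have -> : #|[pred f : {ffun T' -> 'I_k} |
    all (fun z => f z.1 != f z.2) [seq (h z.1, h z.2) | z <- l]]| = #|[predI A & B]|.
  rewrite -(fintype.card_image lftI); apply: eq_card => f.
  apply/fintype.imageP/idP => [[g]|].
    rewrite !inE all_map => gl ->; rewrite !ffunE hx hy eqxx andbT.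
    by apply: sub_all gl => z /=; rewrite !ffunE.
  rewrite !inE => /andP[fl /eqP fxy].
  have E : f = lft [ffun z => f (val z)].
    apply/ffunP => z; rewrite !ffunE.
    have [->|zy] := eqVneq z y; first by rewrite hy.
    by rewrite hK.
  exists [ffun z => f (val z)] => //; rewrite inE all_map.
  by apply: sub_all fl => z /=; rewrite {1 2}E !ffunE.
by rewrite natrD addrC addKr.
Qed.

Lemma chrompolyP (T : finType) (e : rel T) : is_chrompoly e (chrompoly e).
Proof.
suff [p Hp] : exists p, is_chrompoly e p.
  exact: (@xgetPex _ 0 [set p | is_chrompoly e p] (ex_intro _ p Hp)).
have [p Hp] := @ex_constraint_poly _ T [seq z <- enum {: T * T} | e z.1 z.2] erefl.
exists p => k; rewrite Hp; congr (_%:R); apply: eq_card => f; rewrite !inE.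
apply/allP/forallP => [H x|H [x y]].
  apply/forallP => y; apply/implyP => exy.
  by apply: (H (x, y)); rewrite mem_filter exy mem_enum.
by rewrite mem_filter => /andP[exy _]; exact: (implyP (forallP (H x) y)).
Qed.

Lemma chrompoly_uniq (T : finType) (e : rel T) (p : {poly int}) :
  is_chrompoly e p -> p = chrompoly e.
Proof.
move=> Hp; apply/eqP; rewrite -subr_eq0; apply: contraT => nz.
set d := p - _ in nz.
have := @max_poly_roots _ d [seq k%:R | k <- iota 0 (size d)] nz.
rewrite size_map size_iota ltnn; apply.
  apply/allP => _ /mapP[k _ ->]; rewrite /root hornerD hornerN Hp.
  by rewrite chrompolyP subrr.
by rewrite map_inj_uniq ?iota_uniq // => i j /eqP; rewrite eqr_nat => /eqP.
Qed.

Lemma finite_Spl (R : realType) (n : nat) (q : R) : finite_set (Spl n q).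
Proof.
pose F (f : {ffun 'I_n * 'I_n -> bool}) : R :=
  (map_poly intr (chrompoly (fun x y => f (x, y)))).[q].
apply: (@sub_finite_set _ _ (F @` setT)); last first.
  exact/finite_image/finite_finset.
move=> _ [e [_ _ ->]]; exists [ffun z => e z.1 z.2] => //; rewrite /F.
congr (map_poly _ (chrompoly _)).[q].
by apply/funext => x; apply/funext => y; rewrite ffunE.
Qed.

(* Main.v *)
(* Vertices 0 and 1 start as an edgeless graph; every later vertex is joined to
   the current end of a path, the spine, and either becomes the new end (a spine
   step) or stays an ear and is also joined to vertex 0 (an ear step).  The
   numbers [a] and [c] of colourings giving vertex 0 and the end of the spine
   equal, resp. different, colours evolve by linear maps, so every word in the two
   steps gives a value of P_G(q).  In the projective coordinate
   z = (a + c) / ((q - 1) a - c) a spine step is multiplication by 1 - q, a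
   contraction.  Two words of equal length, many spine steps, alternatively
   preceded by one or two ear steps, therefore map a neighbourhood of z = 0 into
   disjoint parts of itself, and a ping-pong argument yields exponentially many
   vectors (a, c).  Two values on the same number of vertices determine (a, c),
   which costs only a square root. *)
Require Import Defs.
From mathcomp Require Import all_boot all_order all_algebra finmap.
From mathcomp Require Import all_classical all_reals all_analysis.
From mathcomp Require Import ring lra zify.

Set Implicit Arguments.
Unset Strict Implicit.
Unset Printing Implicit Defensive.

Import Order.TTheory GRing.Theory Num.Theory.
Import numFieldNormedType.Exports.

Local Open Scope ring_scope.

(** * Ear graphs and their transfer maps *)

(* [spine ear i] is the last vertex before [i] that is not an ear. *)
Fixpoint spine (ear : nat -> bool) (i : nat) : nat :=
  if i is j.+1 then (if ear j then spine ear j else j) else 0.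

(** Edges are oriented towards the later vertex. The guard [1 < i] is needed because [spine] is 0 at
    0 and at 1: it rules out a loop at 0 and an edge between 0 and 1. *)
Definition edge (ear : nat -> bool) (j i : nat) : bool :=
  (1 < i)%N && ((j == spine ear i) || ear i && (j == 0)).

Definition ear_graph (ear : nat -> bool) (n : nat) : rel 'I_n :=
  fun u v => edge ear u v || edge ear v u.

(** The pair counts colourings in which vertex 0 and the spine end agree, resp. differ. An ear
    leaves both colours alone and has one, resp. two, forbidden colours. A new spine end can take
    the colour of vertex 0 only if the old end did not have it. *)
Definition step (R : comNzRingType) (x : R) (v : R * R) (b : bool) : R * R :=
  if b then ((x - 1) * v.1, (x - 2) * v.2)
  else (v.2, (x - 1) * v.1 + (x - 2) * v.2).

Definition transfer (R : comNzRingType) (x : R) (w : seq bool) : R * R :=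
  foldl (step x) (x, x * (x - 1)) w.

Lemma spine_lt (ear : nat -> bool) (i : nat) : (0 < i)%N -> (spine ear i < i)%N.
Proof.
elim: i => //= i IH _; case: ifP => // _; case: i IH => //= i IH.
by apply: ltnW; apply: IH.
Qed.

Lemma spine_max (ear : nat -> bool) (k i : nat) :
  (k < i)%N -> ~~ ear k -> (k <= spine ear i)%N.
Proof.
elim: i => //= i IH; rewrite ltnS leq_eqVlt => /orP[/eqP->|ki] ek.
  by rewrite (negbTE ek).
by case: ifP => _; [exact: IH|exact: ltnW].
Qed.

Lemma spine_notin_ear (ear : nat -> bool) (i : nat) :
  ear 0 = false -> ~~ ear (spine ear i).
Proof. by move=> e0; elim: i => [|i IH] /=; [rewrite e0|case: ifP => // ->]. Qed.

Lemma spine_homo (ear : nat -> bool) : {homo spine ear : i j / (i <= j)%N}.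
Proof.
apply: homo_leq => //=; first exact: leq_trans.
move=> i; case: ifP => // _; case: i => //= i.
by have := @spine_lt ear i.+1 isT; rewrite /=; apply: ltnW.
Qed.

Lemma edge_lt (ear : nat -> bool) (j i : nat) : edge ear j i -> (j < i)%N.
Proof.
case/andP=> i1 /orP[/eqP->|/andP[_ /eqP->]]; last exact: ltnW.
by apply: spine_lt; exact: ltnW.
Qed.

(** One recursion over any commutative ring serves for the polynomial ([x = 'X]), for its values at
    numbers of colours, and for its value at real [q]; evaluation morphisms link the three. *)
Lemma transfer_rmorph (R S : comNzRingType) (f : {rmorphism R -> S}) (x : R)
    (w : seq bool) :
  transfer (f x) w = (f (transfer x w).1, f (transfer x w).2).
Proof.
elim/last_ind: w => [|w b IH]; first by rewrite /= rmorphM rmorphB rmorph1.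
rewrite /transfer !foldl_rcons -!/(transfer _ w) IH /step.
by case: b; rewrite /= ?rmorphD !rmorphM !rmorphB rmorph1 rmorph_nat.
Qed.

(** * Counting colourings by adding the last vertex *)

Definition ffun_rcons (C : Type) (n : nat) (f : {ffun 'I_n -> C}) (c : C) :
    {ffun 'I_n.+1 -> C} :=
  [ffun i => if unlift ord_max i is Some j then f j else c].

Lemma ffun_rcons_max (C : Type) (n : nat) (f : {ffun 'I_n -> C}) (c : C) :
  ffun_rcons f c ord_max = c.
Proof. by rewrite ffunE unlift_none. Qed.

Lemma ffun_rcons_lift (C : Type) (n : nat) (f : {ffun 'I_n -> C}) (c : C) j :
  ffun_rcons f c (lift ord_max j) = f j.
Proof. by rewrite ffunE liftK. Qed.

Lemma sum_ffun_rcons (C : finType) (V : nmodType) (n : nat)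
    (F : {ffun 'I_n.+1 -> C} -> V) :
  \sum_f F f = \sum_(f : {ffun 'I_n -> C}) \sum_c F (ffun_rcons f c).
Proof.
rewrite pair_big /=.
rewrite (reindex (fun p : {ffun 'I_n -> C} * C => ffun_rcons p.1 p.2)) //=.
exists (fun f : {ffun 'I_n.+1 -> C} => ([ffun j => f (lift ord_max j)], f ord_max)).
  move=> [f c] _ /=; congr pair; last by rewrite ffun_rcons_max.
  by apply/ffunP => j; rewrite ffunE ffun_rcons_lift.
move=> f _; apply/ffunP => i; rewrite ffunE /=.
by case: unliftP => [j|] ->; rewrite ?ffunE.
Qed.

(** Inclusion-exclusion. The case [x = y] covers a single forbidden colour. *)
Lemma sum_avoid2 (k : nat) (x y : 'I_k) :
  \sum_(c < k) ((c != x) && (c != y))%:R = k%:R - 1 - (x != y)%:R :> int.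
Proof.
have E (c : 'I_k) : ((c != x) && (c != y))%:R =
    1 - (c == x)%:R - (x != y)%:R * (c == y)%:R :> int.
  have [->|cx] := eqVneq c x; first by case: eqVneq.
  have [cy|_] := eqVneq c y; last by rewrite mulr0 !subr0.
  by rewrite -cy eq_sym cx mulr1 subr0 subrr.
under eq_bigr do rewrite E.
rewrite !sumrB -mulr_sumr sumr_const card_ord.
have D (z : 'I_k) : \sum_(c < k) (c == z)%:R = 1 :> int.
  by rewrite (bigD1 z) //= eqxx big1 ?addr0 // => c /negbTE ->.
by rewrite !D mulr1.
Qed.

Lemma sum_avoid1_eq (k : nat) (x y : 'I_k) :
  \sum_(c < k) ((c != x) && (c == y))%:R = (x != y)%:R :> int.
Proof.
rewrite (bigD1 y) //= eqxx andbT big1 ?addr0 1?eq_sym // => c /negbTE ->.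
by rewrite andbF.
Qed.

(** Every edge at the last vertex comes from an earlier one, so its only neighbours are the spine
    end and, for an ear, vertex 0. *)
Lemma proper_ffun_rcons (ear : nat -> bool) (n k : nat)
    (f : {ffun 'I_n.+2 -> 'I_k}) (c : 'I_k) :
  proper_coloring (ear_graph ear (n := n.+3)) (ffun_rcons f c) =
  proper_coloring (ear_graph ear (n := n.+2)) f &&
  ((c != f (inord (spine ear n.+2))) && (ear n.+2 ==> (c != f ord0))).
Proof.
have sp : (spine ear n.+2 < n.+2)%N by exact: spine_lt.
apply/idP/idP.
  move=> /forallP H; apply/and3P; split.
  - apply/forallP => x; apply/forallP => y; apply/implyP => exy.
    have /forallP/(_ (lift ord_max y))/implyP := H (lift ord_max x).
    by rewrite !ffun_rcons_lift; apply; rewrite /ear_graph !lift_max.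
  - have /forallP/(_ (lift ord_max (inord (spine ear n.+2))))/implyP := H ord_max.
    rewrite ffun_rcons_max ffun_rcons_lift; apply.
    by rewrite /ear_graph !lift_max inordK // {2}/edge eqxx orbT.
  - apply/implyP => en.
    have /forallP/(_ (lift ord_max ord0))/implyP := H ord_max.
    rewrite ffun_rcons_max ffun_rcons_lift; apply.
    by rewrite /ear_graph !lift_max {2}/edge [ord_max : nat]/= en !orbT.
move=> /and3P[/forallP H cs ce].
have key (j : 'I_n.+2) : edge ear j n.+2 -> c != f j.
  case/andP=> _ /orP[/eqP js|/andP[en /eqP j0]].
    by rewrite (_ : j = inord (spine ear n.+2)) // -js inord_val.
  by rewrite (_ : j = ord0) ?(implyP ce) //; apply: val_inj.
apply/forallP => x; apply/forallP => y; apply/implyP; rewrite /ear_graph.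
case: (unliftP ord_max x) => [x'|] ->; case: (unliftP ord_max y) => [y'|] ->;
  rewrite ?ffun_rcons_max ?ffun_rcons_lift ?lift_max.
- by move=> exy; have /forallP/(_ y')/implyP := H x'; apply.
- case/orP => [/key|/edge_lt]; first by rewrite eq_sym.
  by move/ltn_trans/(_ (ltn_ord x')); rewrite ltnn.
- case/orP => [/edge_lt|/key] //.
  by move/ltn_trans/(_ (ltn_ord y')); rewrite ltnn.
- by case/orP => /edge_lt; rewrite ltnn.
Qed.

Definition equal_end_colorings (ear : nat -> bool) (n k : nat) (b : bool) : int :=
  \sum_(f : {ffun 'I_n.+2 -> 'I_k})
    (proper_coloring (ear_graph ear (n := n.+2)) f &&
     ((f ord0 == f (inord (spine ear n.+2))) == b))%:R.

Lemma equal_end_coloringsE (ear : nat -> bool) (n k : nat) :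
  ear 0 = false -> ear 1 = false ->
  (equal_end_colorings ear n k true, equal_end_colorings ear n k false) =
  transfer k%:R (mkseq (fun i => ear i.+2) n).
Proof.
move=> e0 e1; elim: n => [|n IH].
  have E b : equal_end_colorings ear 0 k b = \sum_(c < k) \sum_(d < k) ((c == d) == b)%:R.
    rewrite /equal_end_colorings sum_ffun_rcons.
    rewrite sum_ffun_rcons.
    rewrite (big_pred1 (@ffun0 _ (fun=> 'I_k) (card_ord 0))); last first.
      by move=> f; apply/esym/eqP/ffunP; case.
    apply: eq_bigr => c _; apply: eq_bigr => d _.
    have -> : inord (spine ear 2) = ord_max :> 'I_2.
      by apply: val_inj; rewrite /= e1 inordK.
    have -> : ord0 = lift ord_max ord_max :> 'I_2 by apply: val_inj.
    rewrite ffun_rcons_lift !ffun_rcons_max; congr (nat_of_bool _)%:R.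
    rewrite andb_idl // => _; apply/forallP => x; apply/forallP => y.
    apply/implyP; rewrite /ear_graph /edge.
    by case: x => [[|[|]]] // ?; case: y => [[|[|]]].
  rewrite !E /transfer /=; congr pair.
    rewrite (eq_bigr (fun=> 1)) ?sumr_const ?card_ord // => c _.
    rewrite (bigD1 c) //= eqxx big1 ?addr0 // => d /negbTE dc.
    by rewrite eqb_id eq_sym dc.
  rewrite (eq_bigr (fun=> k%:R - 1)) ?sumr_const ?card_ord ?[RHS]mulr_natl // => c _.
  under eq_bigr => d _ do rewrite eqbF_neg eq_sym -[_ != _]andbb.
  by rewrite sum_avoid2 eqxx subr0.
rewrite mkseqS /transfer foldl_rcons -/(transfer _ _) -IH /step /=.
set s : 'I_n.+2 := inord (spine ear n.+2).
have sE : s = spine ear n.+2 :> nat by rewrite inordK // spine_lt.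
(* An ear keeps [s] as spine end; otherwise the new vertex, of colour [c], is the end. *)
have rec b : equal_end_colorings ear n.+1 k b =
  \sum_(f : {ffun 'I_n.+2 -> 'I_k})
     (proper_coloring (ear_graph ear (n := n.+2)) f)%:R *
     \sum_c (((c != f s) && (ear n.+2 ==> (c != f ord0))) &&
              ((f ord0 == if ear n.+2 then f s else c) == b))%:R.
  rewrite /equal_end_colorings sum_ffun_rcons; apply: eq_bigr => f _.
  rewrite mulr_sumr; apply: eq_bigr => c _.
  rewrite proper_ffun_rcons -natrM mulnb [in RHS]andbA.
  congr (nat_of_bool (_ && (_ == _)))%:R.
  have -> : ord0 = lift ord_max ord0 :> 'I_n.+3 by apply: val_inj.
  rewrite ffun_rcons_lift; congr (_ == _).
  have -> : inord (spine ear n.+3) =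
      if ear n.+2 then lift ord_max s else ord_max :> 'I_n.+3.
    apply: val_inj; rewrite [LHS]inordK ?spine_lt //.
    have -> : spine ear n.+3 = if ear n.+2 then spine ear n.+2 else n.+2 by [].
    by case: ifP => // _; rewrite [RHS]lift_max sE.
  by case: ifP => _; rewrite ?ffun_rcons_lift ?ffun_rcons_max.
rewrite !rec; case: ifP => en /=; congr pair.
- rewrite /equal_end_colorings mulr_sumr; apply: eq_bigr => f _.
  under eq_bigr => c _ do rewrite eqb_id -mulnb natrM.
  rewrite -mulr_suml sum_avoid2 eqb_id -mulnb natrM -/s eq_sym.
  by case: eqVneq => _; rewrite ?mulr0 // subr0; ring.
- rewrite /equal_end_colorings mulr_sumr; apply: eq_bigr => f _.
  under eq_bigr => c _ do rewrite eqbF_neg -mulnb natrM.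
  rewrite -mulr_suml sum_avoid2 eqbF_neg -mulnb natrM -/s eq_sym.
  by case: eqVneq => _; rewrite ?mulr0 //=; ring.
- rewrite /equal_end_colorings; apply: eq_bigr => f _.
  under eq_bigr => c _ do rewrite andbT eqb_id [f ord0 == c]eq_sym.
  by rewrite sum_avoid1_eq eqbF_neg -mulnb natrM -/s [f s == _]eq_sym.
- rewrite /equal_end_colorings !mulr_sumr -big_split /=; apply: eq_bigr => f _.
  under eq_bigr => c _ do rewrite andbT eqbF_neg [f ord0 == c]eq_sym.
  rewrite sum_avoid2 eqbF_neg eqb_id -!mulnb !natrM -/s [f s == _]eq_sym.
  by case: eqVneq => _ /=; ring.
Qed.

(* Letter [j] of the word describes vertex [j + 2]. *)
Definition ear_of (w : seq bool) (i : nat) : bool :=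
  if i is j.+2 then nth false w j else false.

(** A polynomial is determined by its values at the naturals, and there the colourings split
    according to whether vertex 0 and the spine end agree. *)
Lemma chrompoly_ear_graph (w : seq bool) :
  chrompoly (ear_graph (ear_of w) (n := (size w).+2)) =
  (transfer 'X w).1 + (transfer 'X w).2.
Proof.
apply/esym/chrompoly_uniq => k; rewrite hornerD.
have := transfer_rmorph (horner_eval (k%:R : int)) 'X w.
rewrite /= /horner_eval hornerX => H.
have := @equal_end_coloringsE (ear_of w) (size w) k erefl erefl.
rewrite mkseq_nth H => -[<- <-].
rewrite /equal_end_colorings -big_split /num_colorings -sum1_card natr_sum.
rewrite [RHS]big_mkcond; apply: eq_bigr => f _; rewrite !inE /=.
by case: proper_coloring => //; case: (f ord0 == _).
Qed.

Lemma chrompoly_ear_graph_eval (R : realType) (q : R) (w : seq bool) :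
  (map_poly intr (chrompoly (ear_graph (ear_of w) (n := (size w).+2)))).[q] =
  (transfer q w).1 + (transfer q w).2.
Proof.
rewrite chrompoly_ear_graph rmorphD hornerD.
have := transfer_rmorph (horner_eval q \o map_poly (intr : int -> R)) 'X w.
by rewrite /= /horner_eval map_polyX hornerX => ->.
Qed.

(** * A straight-line plane drawing of ear graphs *)

(* Spine edges run along the line y = 0, the other edges at an ear lie in the
   strips 0 < y < 1 and 1 < y < 2. *)
Definition vertex_pt (R : realType) (ear : nat -> bool) (i : nat) : R * R :=
  if i is 0 then (0, 2) else (i%:R, (ear i)%:R).

Definition segment (R : realType) (x y : R * R) (t : R) : R * R :=
  ((1 - t) * x.1 + t * y.1, (1 - t) * x.2 + t * y.2).

Lemma segmentC (R : realType) (x y : R * R) (t : R) :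
  segment x y t = segment y x (1 - t).
Proof. by rewrite /segment subKr addrC [X in (_, X)]addrC. Qed.

Lemma continuous_segment (R : realType) (x y : R * R) : continuous (segment x y).
Proof.
move=> t; apply: (@cvg_pair _ _ _ _ (nbhs _) (nbhs _)); apply: cvgD; apply: cvgM;
  first [exact: cvg_cst | exact: cvg_id | by apply: cvgB; [exact: cvg_cst|exact: cvg_id]].
Qed.

Lemma segment_inj (R : realType) (x y : R * R) : x <> y -> injective (segment x y).
Proof.
move=> xy s t [E1 E2]; apply/eqP; rewrite -subr_eq0; apply/negPn/negP => st.
apply: xy; case: x y E1 E2 => [x1 x2] [y1 y2] /= E1 E2.
have F1 : (s - t) * (x1 - y1) = 0 by lra.
have F2 : (s - t) * (x2 - y2) = 0 by lra.
move/eqP: F1; rewrite mulf_eq0 (negbTE st) subr_eq0 => /eqP ->.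
by move/eqP: F2; rewrite mulf_eq0 (negbTE st) subr_eq0 => /eqP ->.
Qed.

Lemma vertex_pt_inj (R : realType) (ear : nat -> bool) : injective (@vertex_pt R ear).
Proof.
case=> [|i] [|j] //= []; first by move/eqP; rewrite eq_sym pnatr_eq0.
- by move/eqP; rewrite pnatr_eq0.
- by move=> /eqP; rewrite eqr_nat => /eqP.
Qed.

Variant edge_spec (R : realType) (ear : nat -> bool) (j i : nat) : (R -> R * R) -> Prop :=
| SpineEdge : j = spine ear i -> ~~ ear i ->
    edge_spec ear j i (fun t => ((1 - t) * j%:R + t * i%:R, 0))
| FootEdge : j = spine ear i -> ear i ->
    edge_spec ear j i (fun t => ((1 - t) * j%:R + t * i%:R, t))
| ApexEdge : j = 0 -> ear i -> edge_spec ear j i (fun t => (t * i%:R, 2 - t)).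

Lemma spine_gt0 (ear : nat -> bool) (i : nat) :
  ear 1 = false -> (1 < i)%N -> (0 < spine ear i)%N.
Proof. by move=> e1 i1; apply: spine_max; rewrite ?e1. Qed.

Lemma edgeP (R : realType) (ear : nat -> bool) (j i : nat) :
  ear 0 = false -> ear 1 = false -> edge ear j i ->
  edge_spec ear j i (segment (@vertex_pt R ear j) (vertex_pt R ear i)).
Proof.
move=> e0 e1 /andP[i1 eji]; have s0 := spine_gt0 e1 i1.
have ptE k : (0 < k)%N -> vertex_pt R ear k = (k%:R, (ear k)%:R) by case: k.
case/orP: eji => [/eqP js|/andP[ei /eqP ->]]; last first.
  have -> : segment (vertex_pt R ear 0) (vertex_pt R ear i) =
            (fun t => (t * i%:R, 2 - t)).
    apply/funext => t; rewrite /segment (ptE i) 1?ltnW // ei /=; congr pair; ring.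
  exact: ApexEdge.
have ej : ear j = false by apply/negbTE; rewrite js spine_notin_ear.
case: (boolP (ear i)) => ei.
  have -> : segment (vertex_pt R ear j) (vertex_pt R ear i) =
            (fun t => ((1 - t) * j%:R + t * i%:R, t)).
    apply/funext => t; rewrite /segment (ptE i) 1?ltnW // (ptE j) ?js //= -js ei ej.
    by congr pair; rewrite /=; ring.
  exact: FootEdge.
have -> : segment (vertex_pt R ear j) (vertex_pt R ear i) =
          (fun t => ((1 - t) * j%:R + t * i%:R, 0)).
  apply/funext => t; rewrite /segment (ptE i) 1?ltnW // (ptE j) ?js //= -js (negbTE ei) ej.
  by congr pair; rewrite /=; ring.
exact: SpineEdge.
Qed.

Lemma convex_between (R : realType) (a b t : R) :
  a < b -> 0 < t -> t < 1 -> a < (1 - t) * a + t * b /\ (1 - t) * a + t * b < b.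
Proof.
move=> ab t0 t1; have ba : 0 < b - a by lra.
have t1' : 0 < 1 - t by lra.
by have := mulr_gt0 t0 ba; have := mulr_gt0 t1' ba; lra.
Qed.

(** Inside the two strips heights are not integers, while vertices have height 0, 1 or 2. On the
    line y = 0 only non-ears could interfere, and by [spine_max] none lies strictly between
    [spine ear i] and [i]. *)
Lemma segment_avoids_vertex (R : realType) (ear : nat -> bool) (j i w : nat) (t : R) :
  ear 0 = false -> ear 1 = false -> edge ear j i -> 0 < t < 1 ->
  segment (vertex_pt R ear j) (vertex_pt R ear i) t <> vertex_pt R ear w.
Proof.
move=> e0 e1 eji /andP[t0 t1]; have ji := edge_lt eji.
have ji' : j%:R < i%:R :> R by rewrite ltr_nat.
have [jx xi] := convex_between ji' t0 t1.
case: (edgeP R e0 e1 eji) => js ei; case: w => [|w] //= [].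
- by move=> _ /eqP; rewrite eq_sym pnatr_eq0.
- case: (boolP (ear w.+1)) => ew H1 /= H2; first by lra.
  case: (ltnP w.+1 i) => wi.
    have := spine_max wi ew; rewrite -js -(ler_nat R) => wj; lra.
  by move: wi; rewrite -(ler_nat R) => wi; lra.
- by move=> _ ?; lra.
- by case: (ear w.+1) => _ /= ?; lra.
- by move=> _ ?; lra.
- by case: (ear w.+1) => _ /= ?; lra.
Qed.

(** Edges of different kinds are separated by height. For [i < i'], two spine edges cover intervals
    with disjoint interiors; two foot edges compared at the same height keep their order, since
    [spine] is monotone; two edges at vertex 0 fan out from a common point. *)
Lemma segments_disjoint (R : realType) (ear : nat -> bool) (j i j' i' : nat) (s t : R) :
  ear 0 = false -> ear 1 = false -> edge ear j i -> edge ear j' i' ->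
  0 < s < 1 -> 0 < t < 1 ->
  segment (vertex_pt R ear j) (vertex_pt R ear i) s =
  segment (vertex_pt R ear j') (vertex_pt R ear i') t -> j = j' /\ i = i'.
Proof.
move=> e0 e1; wlog le_ii : j i j' i' s t / (i <= i')%N => [H|].
  case: (leqP i i') => [le_ii|/ltnW ii']; first exact: H.
  move=> eji eji' s01 t01 E.
  by case: (H _ _ _ _ t s ii' eji' eji t01 s01 (esym E)).
move=> eji eji' /andP[s0 s1] /andP[t0 t1].
have ji : j%:R < i%:R :> R by rewrite ltr_nat (edge_lt eji).
have ji' : j'%:R < i'%:R :> R by rewrite ltr_nat (edge_lt eji').
have [jx xi] := convex_between ji s0 s1.
have [jx' xi'] := convex_between ji' t0 t1.
have sp := spine_homo ear le_ii; rewrite -(ler_nat R) in sp.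
have := le_ii; rewrite leq_eqVlt => /orP[/eqP ii'|lt_ii].
  subst i'; case: (edgeP R e0 e1 eji) => js ei; case: (edgeP R e0 e1 eji') => js' ei';
  rewrite ?js ?js' //; try (by rewrite ei in ei'); try (by rewrite ei' in ei);
  by case=> _ E; exfalso; clear -s0 s1 t0 t1 E; lra.
have lt_ii' : i%:R < i'%:R :> R by rewrite ltr_nat.
case: (edgeP R e0 e1 eji) => js ei; case: (edgeP R e0 e1 eji') => js' ei' E;
  have /= E1 := congr1 fst E; have /= E2 := congr1 snd E; clear E;
  try (by exfalso; clear -s0 s1 t0 t1 E2; lra); exfalso; rewrite -?js -?js' in sp.
- by have := spine_max lt_ii ei; rewrite -js' -(ler_nat R) => ij'; clear -E1 xi jx' ij'; lra.
- clear js js' ei ei'; subst t.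
  have h1 : 0 <= (1 - s) * (j'%:R - j%:R) by apply: mulr_ge0; lra.
  have h2 : 0 < s * (i'%:R - i%:R) by apply: mulr_gt0; lra.
  lra.
- clear js js' ei ei'; have st : s = t by lra.
  have : 0 < t * (i'%:R - i%:R) by apply: mulr_gt0; lra.
  rewrite st in E1; lra.
Qed.

Lemma planar_ear_graph (R : realType) (ear : nat -> bool) (n : nat) :
  ear 0 = false -> ear 1 = false -> planar R (ear_graph ear (n := n)).
Proof.
move=> e0 e1; exists (fun u : 'I_n => vertex_pt R ear u).
exists (fun u v : 'I_n => segment (vertex_pt R ear u) (vertex_pt R ear v)).
have lt01 (t : R) : t \in `]0, 1[ -> 0 < t < 1 /\ 0 < 1 - t < 1.
  by rewrite in_itv /= => /andP[? ?]; split; apply/andP; split; lra.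
split.
- by move=> u v /vertex_pt_inj /val_inj.
- move=> u v euv; split.
  + exact/continuous_subspaceT/continuous_segment.
  + move=> s t _ _; apply: segment_inj => /vertex_pt_inj uv.
    by case/orP: euv => /edge_lt; rewrite uv ltnn.
  + by rewrite /segment subr0 !mul1r !mul0r !addr0; case: vertex_pt.
  + by rewrite /segment subrr !mul1r !mul0r !add0r; case: vertex_pt.
  + by move=> t _; exact: segmentC.
- move=> u v w euv t /lt01[t01 t01'].
  by case/orP: euv => euv; [|rewrite segmentC]; exact: segment_avoids_vertex.
- move=> u v u' v' euv euv' s t /lt01[s01 s01'] /lt01[t01 t01'].
  case/orP: euv => euv; case/orP: euv' => euv'.
  + move=> E; left; case: (segments_disjoint e0 e1 euv euv' s01 t01 E).
    by move=> /val_inj -> /val_inj ->.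
  + rewrite [RHS]segmentC => E; right.
    case: (segments_disjoint e0 e1 euv euv' s01 t01' E).
    by move=> /val_inj -> /val_inj ->.
  + rewrite [LHS]segmentC => E; right.
    case: (segments_disjoint e0 e1 euv euv' s01' t01 E).
    by move=> /val_inj -> /val_inj ->.
  + rewrite [LHS]segmentC [RHS]segmentC => E; left.
    case: (segments_disjoint e0 e1 euv euv' s01' t01' E).
    by move=> /val_inj -> /val_inj ->.
Qed.

Lemma simple_ear_graph (ear : nat -> bool) (n : nat) :
  simple_graph (ear_graph ear (n := n)).
Proof.
split=> [u v|u]; first exact: orbC.
by apply/negbTE; rewrite negb_or; apply/andP; split; apply/negP => /edge_lt;
  rewrite ltnn.
Qed.

(** * Ping-pong in the projective coordinate *)

(* [cone_y v / cone_x v] is the coordinate at which a spine step acts as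
   multiplication by [1 - q]. *)
Definition cone_x (R : comNzRingType) (q : R) (v : R * R) : R := (q - 1) * v.1 - v.2.

Definition cone_y (R : comNzRingType) (v : R * R) : R := v.1 + v.2.

(** The neighbourhood |z| <= [d] of z = 0 in homogeneous form, where z is [cone_y v / cone_x v]; the
    first condition excludes infinity and the zero vector. *)
Definition cone (R : realType) (q d : R) (v : R * R) : Prop :=
  cone_x q v <> 0 /\ `|cone_y v| <= d * `|cone_x q v|.

Definition block (m N : nat) (b : bool) : seq bool :=
  if b then nseq m true ++ nseq N false else nseq (m + N) false.

(** The head of [t] is the last block applied. The initial vector has [cone_x] equal to 0, the
    repelling direction of the spine step; the first ear moves it away, and the [K] spine steps then
    bring it into the cone and adjust the number of vertices. *)
Fixpoint code (m N K : nat) (t : seq bool) : seq bool :=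
  if t is b :: t' then code m N K t' ++ block m N b else true :: nseq K false.

Lemma size_code (m N K : nat) (t : seq bool) :
  size (code m N K t) = (size t * (m + N) + K).+1.
Proof.
elim: t => [|b t IH] /=; first by rewrite size_nseq.
rewrite size_cat IH /block; case: b; rewrite ?size_cat !size_nseq; lia.
Qed.

(** The determinants of the ear and spine steps are (q - 1)(q - 2) and 1 - q. *)
Lemma foldl_step_inj (R : realType) (q : R) (w : seq bool) :
  q <> 1 -> q <> 2 -> injective (fun v => foldl (step q) v w).
Proof.
move=> q1 q2; have /mulfI i1 : q - 1 != 0 by rewrite subr_eq0; apply/eqP.
have /mulfI i2 : q - 2 != 0 by rewrite subr_eq0; apply/eqP.
elim: w => [|b w IH] //= u v /IH; case: u v => [a c] [a' c'].
case: b => -[] /=; first by move=> /i1 -> /i2 ->.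
by move=> -> /addIr /i1 ->.
Qed.

(** [cone_y] and [cone_x] are eigenforms of the spine step, with eigenvalues q - 1 and -1. *)
Lemma foldl_spine_steps (R : realType) (q : R) (K : nat) (v : R * R) :
  cone_y (foldl (step q) v (nseq K false)) = (q - 1) ^+ K * cone_y v /\
  cone_x q (foldl (step q) v (nseq K false)) = (-1) ^+ K * cone_x q v.
Proof.
elim: K v => [|K IH] v; first by rewrite !expr0 !mul1r.
have [/= -> ->] := IH (step q v false).
by rewrite /cone_y /cone_x /= !exprS; split; ring.
Qed.

Lemma foldl_ear_steps (R : realType) (q : R) (m : nat) (v : R * R) :
  foldl (step q) v (nseq m true) = ((q - 1) ^+ m * v.1, (q - 2) ^+ m * v.2).
Proof.
elim: m v => [|m IH] [a c]; first by rewrite /= !expr0 !mul1r.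
by rewrite /= IH /= !exprSr !mulrA.
Qed.

(* The exponent [m] is such that [m] ear steps move the attracting direction
   [cone_y = 0] of the spine step neither to itself nor to the repelling
   direction [cone_x = 0]; [m = 1] fails exactly at the golden ratio. *)
Lemma ear_exponent (R : realType) (q : R) : 0 < q -> q < 2 ->
  exists m : nat, [/\ (0 < m)%N, (q - 1) ^+ m - (q - 2) ^+ m <> 0 &
    (q - 1) * (q - 1) ^+ m + (q - 2) ^+ m <> 0].
Proof.
move=> q0 q2; have [g|g] := eqVneq (q * q) (q + 1).
  exists 2%N; rewrite !expr2; split=> // E; nra.
exists 1%N; rewrite !expr1; split=> // E; first by lra.
by move/eqP: g; apply; lra.
Qed.

Lemma perturbation (R : realType) (u c d z : R) :
  `|c| * d <= `|u| / 2 -> `|z| <= d ->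
  `|u| / 2 <= `|u + c * z| /\ `|u + c * z| <= 2 * `|u|.
Proof.
move=> cd zd.
have : `|c * z| <= `|u| / 2.
  by rewrite normrM; apply: le_trans cd; apply: ler_wpM2l.
have := ler_normD u (c * z); have := ler_normB (u + c * z) (c * z); rewrite addrK.
have := normr_ge0 u; lra.
Qed.

(* [m] ear steps send the cone to ratios [cone_y / cone_x] bounded away from 0
   and infinity, so the common [N] spine steps bring both images back into the
   cone without merging them. *)
Lemma separating_blocks (R : realType) (q : R) : 0 < q -> q < 2 -> q <> 1 ->
  exists (d : R) (m N : nat), [/\ (0 < m + N)%N, 0 < d,
    forall K v, (N <= K)%N -> cone_x q v <> 0 -> `|cone_y v| <= `|cone_x q v| ->
      cone q d (foldl (step q) v (nseq K false)),
    forall b v, cone q d v -> cone q d (foldl (step q) v (block m N b)) &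
    forall v v', cone q d v -> cone q d v' ->
      foldl (step q) v (block m N true) <> foldl (step q) v' (block m N false)].
Proof.
move=> q0 q2 q1; have [m [m0 u1 u2]] := ear_exponent q0 q2.
set r := (q - 1) ^+ m in u1 u2; set s := (q - 2) ^+ m in u1 u2.
set u := r - s in u1; set w := (q - 1) * r + s in u2.
set c1 := r + s * (q - 1); set c2 := (q - 1) * (r - s).
have nu : 0 < `|u| by rewrite normr_gt0; apply/eqP.
have nw : 0 < `|w| by rewrite normr_gt0; apply/eqP.
(* The first two summands make [perturbation] applicable to [u] and [w], the third separates the two
   images, and the last gives [d <= 1]. *)
pose D : R := 2 * (`|c1| + 1) / `|u| + 2 * (`|c2| + 1) / `|w| + 8 * `|w| / `|u| + 1.
pose d := D^-1.
have D1 : [/\ 2 * (`|c1| + 1) <= `|u| * D, 2 * (`|c2| + 1) <= `|w| * D,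
     8 * `|w| < `|u| * D & 1 <= D].
  pose x1 := 2 * (`|c1| + 1) / `|u|; pose x2 := 2 * (`|c2| + 1) / `|w|.
  pose x3 := 8 * `|w| / `|u|.
  have [p1 p2 p3] : [/\ 0 <= x1, 0 <= x2 & 0 <= x3].
    by split; apply: divr_ge0 => //; have := normr_ge0 c1; have := normr_ge0 c2; lra.
  have e1 : x1 * `|u| = 2 * (`|c1| + 1) by rewrite divfK // lt0r_neq0.
  have e2 : x2 * `|w| = 2 * (`|c2| + 1) by rewrite divfK // lt0r_neq0.
  have e3 : x3 * `|u| = 8 * `|w| by rewrite divfK // lt0r_neq0.
  rewrite /D -/x1 -/x2 -/x3; split; [rewrite -e1|rewrite -e2|rewrite -e3|lra].
  - by rewrite mulrC ler_pM2l //; lra.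
  - by rewrite mulrC ler_pM2l //; lra.
  - by rewrite mulrC ltr_pM2l //; lra.
have [D1a D1b D1c D1d] := D1.
have Dpos : 0 < D by lra.
have d0 : 0 < d by rewrite invr_gt0.
have dD : d * D = 1 by rewrite mulVf // lt0r_neq0.
have mulD (x y : R) : x <= y * D -> x * d <= y.
  by move=> xy; rewrite /d ler_pdivrMr.
have b1 : `|c1| * d <= `|u| / 2.
  by apply: mulD; have := normr_ge0 c1; lra.
have b2 : `|c2| * d <= `|w| / 2.
  by apply: mulD; have := normr_ge0 c2; lra.
have b3 : 8 * `|w| * d < `|u| by rewrite /d ltr_pdivrMr.
have d1 : d <= 1 by rewrite -dD ler_peMr // ltW.
set p := `|q - 1|.
have p0 : 0 < p by rewrite normr_gt0 subr_eq0; apply/eqP.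
have p1 : p < 1 by rewrite ltr_norml; apply/andP; split; lra.
(* After the ear steps the ratio of |[cone_y]| to |[cone_x]| is at most 4|u|/|w|; the added 1 also
   yields [p ^+ N <= d], for starting vectors of ratio at most 1. *)
have [N HN] : exists N, p ^+ N * (4 * `|u| / `|w| + 1) <= d.
  have M0 : 0 < 4 * `|u| / `|w| + 1.
    by rewrite ltr_wpDl // divr_ge0 // mulr_ge0.
  have := @cvg_expr R p; rewrite ger0_norm ?ltW // => /(_ p1).
  move=> /cvgrPdist_le /(_ (d / (4 * `|u| / `|w| + 1))).
  move=> /(_ (divr_gt0 d0 M0)) [N _ /(_ N (leqnn N))] /=.
  rewrite sub0r normrN (ger0_norm (exprn_ge0 N (ltW p0))) => H.
  by exists N; rewrite -ler_pdivlMr.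
have pN0 n : 0 < p ^+ n by rewrite exprn_gt0.
have pN1 n : p ^+ n <= 1 by rewrite exprn_ile1 // ltW.
have HN1 : p ^+ N <= d.
  apply: le_trans HN; rewrite (ler_peMr (ltW (pN0 N))) // lerDr divr_ge0 // mulr_ge0 //.
have HN2 : p ^+ N * (4 * `|u|) <= d * `|w|.
  rewrite -ler_pdivrMr // -mulrA; apply: le_trans HN.
  by rewrite ler_pM2l // lerDl.
(* The factor [q] clears denominators: q v.1 = x + y and q v.2 = (q - 1) y - x, with x =
   [cone_x q v] and y = [cone_y v]. *)
have ears v : q * cone_y (foldl (step q) v (nseq m true)) =
      u * cone_x q v + c1 * cone_y v /\
    q * cone_x q (foldl (step q) v (nseq m true)) =
      w * cone_x q v + c2 * cone_y v.
  rewrite foldl_ear_steps -/r -/s /cone_x /cone_y /u /w /c1 /c2 /=.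
  by split; ring.
(* The factor 4 combines a factor 2 from each of the two perturbation bounds. *)
have earsB v : cone q d v -> let v' := foldl (step q) v (nseq m true) in
    [/\ cone_x q v' <> 0, `|u| * `|cone_x q v'| <= 4 * `|w| * `|cone_y v'| &
      `|w| * `|cone_y v'| <= 4 * `|u| * `|cone_x q v'|].
  move=> [x0 yx] /=; set v' := foldl _ _ _.
  have nx : 0 < `|cone_x q v| by rewrite normr_gt0; apply/eqP.
  have [z yz zd] : exists2 z, cone_y v = z * cone_x q v & `|z| <= d.
    exists (cone_y v / cone_x q v); first by rewrite divfK //; apply/eqP.
    by rewrite normrM normfV ler_pdivrMr.
  have [] := ears v; rewrite -/v' yz => ey ex.
  have {}ey : q * `|cone_y v'| = `|u + c1 * z| * `|cone_x q v|.
    by rewrite -normrM -{1}(gtr0_norm q0) -normrM ey; congr `|_|; ring.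
  have {}ex : q * `|cone_x q v'| = `|w + c2 * z| * `|cone_x q v|.
    by rewrite -normrM -{1}(gtr0_norm q0) -normrM ex; congr `|_|; ring.
  have [l1 l2] := perturbation b1 zd; have [l3 l4] := perturbation b2 zd.
  split.
  - move=> E; move: ex; rewrite E normr0 mulr0 => /esym/eqP.
    by rewrite mulf_eq0 (gt_eqF nx) orbF => /eqP; lra.
  - rewrite -(ler_pM2l q0).
    have -> : q * (`|u| * `|cone_x q v'|) = `|u| * (q * `|cone_x q v'|) by ring.
    have -> : q * (4 * `|w| * `|cone_y v'|) = 4 * `|w| * (q * `|cone_y v'|) by ring.
    rewrite ex ey !mulrA ler_pM2r //.
    apply: (le_trans (ler_wpM2l (normr_ge0 u) l4)).
    by have := ler_wpM2l (normr_ge0 w) l1; lra.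
  - rewrite -(ler_pM2l q0).
    have -> : q * (4 * `|u| * `|cone_x q v'|) = 4 * `|u| * (q * `|cone_x q v'|) by ring.
    have -> : q * (`|w| * `|cone_y v'|) = `|w| * (q * `|cone_y v'|) by ring.
    rewrite ex ey !mulrA ler_pM2r //.
    apply: (le_trans (ler_wpM2l (normr_ge0 w) l2)).
    by have := ler_wpM2l (normr_ge0 u) l3; lra.
have spines K v : let v' := foldl (step q) v (nseq K false) in
    `|cone_x q v'| = `|cone_x q v| /\ `|cone_y v'| = p ^+ K * `|cone_y v|.
  rewrite /= (foldl_spine_steps q K v).1 (foldl_spine_steps q K v).2 !normrM.
  by rewrite !normrX normrN1 expr1n mul1r.
exists d, m, N; split=> //.
- by rewrite addn_gt0 m0.
- move=> K v NK x0 yx; have [/= ex ey] := spines K v; split.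
    by move=> E; apply: x0; apply/eqP; rewrite -normr_eq0 -ex E normr0.
  rewrite ex ey; apply: ler_pM => //; first exact: ltW.
  by apply: le_trans HN1; rewrite -(subnK NK) exprD ler_piMl // ltW.
- case=> v cv; rewrite /block.
    rewrite foldl_cat; have [x0 _ yx] := earsB v cv.
    have [/= ex ey] := spines N (foldl (step q) v (nseq m true)); split.
      by move=> E; apply: x0; apply/eqP; rewrite -normr_eq0 -ex E normr0.
    rewrite ex ey -(ler_pM2l nw) mulrCA.
    apply: le_trans (ler_wpM2l (ltW (pN0 N)) yx) _.
    by rewrite !mulrA mulrC mulrA [in leRHS]mulrC in HN2 *; rewrite ler_wpM2r.
  have [x0 yx] := cv; have [/= ex ey] := spines (m + N)%N v; split.
    by move=> E; apply: x0; apply/eqP; rewrite -normr_eq0 -ex E normr0.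
  by rewrite ex ey; apply: le_trans yx; rewrite ler_piMl.
- move=> v v' cv [x0 yx] E; rewrite /block foldl_cat in E.
  have [x1 xy _] := earsB v cv.
  have [/= ex ey] := spines N (foldl (step q) v (nseq m true)).
  have [/= ex' ey'] := spines (m + N)%N v'.
  rewrite -E ex in ex'; rewrite -E ey in ey'.
  (* Both words end in [N] spine steps, whose contraction cancels. What remains has ratio at least
     |u|/(4|w|) by the ears and at most [d] by the spine steps, against 8|w|d < |u|. *)
  rewrite addnC exprD -mulrA in ey'; move/(mulfI (lt0r_neq0 (pN0 N))) : ey' => ey'.
  have nx : 0 < `|cone_x q v'| by rewrite normr_gt0; apply/eqP.
  rewrite ex' ey' in xy.
  have h1 : p ^+ m * `|cone_y v'| <= d * `|cone_x q v'|.
    by apply: le_trans yx; rewrite ler_piMl.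
  have h2 := ler_wpM2l (normr_ge0 w) h1.
  have h3 : (`|u| - 8 * `|w| * d) * `|cone_x q v'| > 0 by apply: mulr_gt0; lra.
  have h4 : 0 <= `|w| * (d * `|cone_x q v'|) by rewrite !mulr_ge0 // ltW.
  lra.
Qed.

(** All vectors reached lie in the cone, so the last block can be read off from the image;
    injectivity of the steps then strips it. *)
Lemma transfer_code_inj (R : realType) (q : R) : 0 < q -> q < 2 -> q <> 1 ->
  exists (p N m : nat), [/\ (0 < p)%N, (m + N = p)%N &
    forall K t t', (N <= K)%N -> size t = size t' ->
      transfer q (code m N K t) = transfer q (code m N K t') -> t = t'].
Proof.
move=> q0 q2 q1.
have [d [m [N [mN d0 init stable sep]]]] := separating_blocks q0 q2 q1.
exists (m + N)%N, N, m; split=> // K t t' NK.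
have codeC b s : transfer q (code m N K (b :: s)) =
    foldl (step q) (transfer q (code m N K s)) (block m N b).
  by rewrite /transfer /= foldl_cat.
have inC s : cone q d (transfer q (code m N K s)).
  elim: s => [|b s IH]; last by rewrite codeC; exact: stable.
  rewrite /transfer /=; apply: init => //.
    have -> : cone_x q ((q - 1) * q, (q - 2) * (q * (q - 1))) = q * (q - 1).
      by rewrite /cone_x /=; ring.
    by move/eqP; rewrite mulf_eq0 subr_eq0 => /orP[/eqP|/eqP]; lra.
  have -> : cone_x q ((q - 1) * q, (q - 2) * (q * (q - 1))) = q * (q - 1).
    by rewrite /cone_x /=; ring.
  have -> : cone_y ((q - 1) * q, (q - 2) * (q * (q - 1))) = q * (q - 1) * (q - 1).
    by rewrite /cone_y /=; ring.
  by rewrite normrM ler_piMr // ler_norml; apply/andP; split; lra.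
have q2' : q <> 2 by lra.
elim: t t' => [|b t IH] [|b' t'] //= [st]; rewrite !codeC.
have [-> E|] := eqVneq b b'.
  by congr cons; apply: IH => //; exact: foldl_step_inj E.
by case: b b' => -[] // _ E; exfalso; [apply: sep E|apply: sep (esym E)].
Qed.

Lemma transfer_Spl (R : realType) (q : R) (w : seq bool) :
  Spl (size w).+2 q ((transfer q w).1 + (transfer q w).2).
Proof.
exists (ear_graph (ear_of w) (n := (size w).+2)); split.
- exact: simple_ear_graph.
- exact: planar_ear_graph.
- by rewrite chrompoly_ear_graph_eval.
Qed.

(* Appending a spine or an ear to the same word yields two values which
   together determine the transfer vector, hence the square. *)
Lemma leq_exp2_Spl (R : realType) (q : R) (L n : nat) (f : L.-tuple bool -> seq bool) :
  q <> 1 -> (forall t, (size (f t)).+3 = n) ->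
  injective (fun t => transfer q (f t)) ->
  (2 ^ L <= #|` fset_set (Spl n q)|%fset ^ 2)%N.
Proof.
move=> q1 sf fI; set X := fset_set _.
pose P t b : R := (transfer q (rcons (f t) b)).1 + (transfer q (rcons (f t) b)).2.
have PX t b : P t b \in X.
  rewrite in_fset_set ?inE; last exact: finite_Spl.
  by rewrite -(sf t) -(size_rcons (f t) b); exact: transfer_Spl.
have gI : injective (fun t => (P t false, P t true)).
  move=> t t' [E1 E2]; apply: fI; move: E1 E2; rewrite /P /transfer !foldl_rcons.
  rewrite -!/(transfer _ _); case: (transfer q (f t)) => a c.
  case: (transfer q (f t')) => a' c' /= E1 E2.
  have /mulfI i1 : q - 1 != 0 by rewrite subr_eq0; apply/eqP.
  have F1 : a + c = a' + c' by apply: i1; lra.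
  by congr pair; lra.
rewrite -{1}card_bool -card_tuple cardE -mulnn.
rewrite -(size_map (fun t => (P t false, P t true))).
rewrite -(size_allpairs (fun x y : R => (x, y)) X X).
apply: uniq_leq_size; first by rewrite map_inj_uniq ?enum_uniq.
by move=> _ /mapP[t _ ->]; apply/allpairsP; exists (P t false, P t true); split; rewrite ?PX.
Qed.

Theorem theorem5p1 (R : realType) (q : R) (hq0 : 0 < q) (hq2 : q < 2)
    (hq1 : q <> 1) :
  exists c : R, 0 < c /\
    exists n0 : nat, forall n : nat, (n0 <= n)%N ->
      2 `^ (c * n%:R) <= (#|` fset_set (Spl n q)|%fset)%:R.
Proof.
have [p [N [m [p0 mN codeI]]]] := transfer_code_inj hq0 hq2 hq1.
have pR : 0 < p%:R :> R by rewrite ltr0n.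
exists (4 * p%:R)^-1; split; first by rewrite invr_gt0 mulr_gt0.
exists (2 * (p + N + 4))%N => n hn.
pose L := ((n - (N + 4)) %/ p)%N; pose K := (N + (n - (N + 4)) %% p)%N.
have nE : (L * p + K + 4 = n)%N.
  by have := divn_eq (n - (N + 4)) p; rewrite -/L /K; lia.
have nL : (n <= 2 * (L * p))%N.
  by have := ltn_pmod (n - (N + 4)) p0; move: nE; rewrite /K; lia.
have sq : (2 ^ L <= #|` fset_set (Spl n q)|%fset ^ 2)%N.
  apply: (leq_exp2_Spl (f := fun t => code m N K t)) => //.
    by move=> t; rewrite size_code size_tuple mN -nE; lia.
  move=> t t' E; apply/val_inj/(codeI K) => //; first exact: leq_addr.
  by rewrite !size_tuple.
rewrite -(@ler_pXn2r _ 2) ?nnegrE ?powR_ge0 ?ler0n // -natrX.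
apply: (@le_trans _ _ (2 ^ L)%:R); last by rewrite ler_nat.
rewrite natrX -!powR_mulrn ?powR_ge0 // -powRrM.
apply: ler_powR; first by rewrite ler1n.
rewrite -mulrA mulrC ler_pdivrMr ?mulr_gt0 //.
have : n%:R <= 2 * (L%:R * p%:R) :> R by rewrite -!natrM ler_nat.
lra.
Qed.
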